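(* Let $X$ be a nonempty completely regular Hausdorff space and let $\mathcal{P}$ be an ideal of closed sets in $X$. The following statements are equivalent: (1) $X$ is almost locally-$\mathcal{P}$; (2) $C_{\mathcal{P}}(X)$ is an essential ideal of $C(X)$; (3) $C^{\mathcal{P}}_{\infty}(X)$ is an essential ideal of $C^*(X)+C^{\mathcal{P}}_{\infty}(X)$.
   Context: $C(X)$ is the ring of all real-valued continuous functions on $X$ and $C^*(X)$ its subring of bounded functions; $Z(f)=\{x\in X: f(x)=0\}$. An ideal of closed sets in $X$ is a nonempty family $\mathcal{P}$ of closed subsets of $X$ such that (i) $A,B\in\mathcal{P}$ implies $A\cup B\in\mathcal{P}$, and (ii) $A\in\mathcal{P}$, $B\subseteq A$ with $B$ closed in $X$ implies $B\in\mathcal{P}$. Set $C_{\mathcal{P}}(X)=\{f\in C(X): \mathrm{cl}_X(X\setminus Z(f))\in\mathcal{P}\}$, which is an ideal of $C(X)$, and $C^{\mathcal{P}}_{\infty}(X)=\{f\in C(X): \{x\in X: |f(x)|\geq\epsilon\}\in\mathcal{P}\text{ for each }\epsilon>0\}$, which is a subring of $C(X)$ and an ideal of the ring $C^*(X)+C^{\mathcal{P}}_{\infty}(X)=\{g+f: g\in C^*(X), f\in C^{\mathcal{P}}_{\infty}(X)\}$. $X$ is almost locally-$\mathcal{P}$ if each nonempty open set $U$ in $X$ contains a nonempty open set $V$ such that $\mathrm{cl}_X V\in\mathcal{P}$. A nonzero (not necessarily proper) ideal $I$ in a commutative ring $R$ is essential if it intersects each nonzero ideal of $R$ nontrivially;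 equivalently (here), for each $a\neq 0$ in $R$ there is $b\neq 0$ in $R$ with $ab\neq 0$ and $ab\in I$. *)

(* Defs.v *)
From HB Require Import structures.
From mathcomp Require Import all_boot all_order all_algebra.
From mathcomp Require Import all_classical all_reals all_analysis.

Set Implicit Arguments.
Unset Strict Implicit.
Unset Printing Implicit Defensive.

Import Order.TTheory GRing.Theory Num.Theory.
Import numFieldNormedType.Exports.

Local Open Scope classical_set_scope.
Local Open Scope ring_scope.

(* MathComp's [idealr] only covers proper ideals, given by boolean predicates;
   here an ideal may be the whole ring. *)
Definition is_ideal (A : comPzRingType) (I : set A) : Prop :=
  [/\ I 0,
      forall a b, I a -> I b -> I (a + b) &
      forall r a, I a -> I (r * a)].

Definition essential_ideal (A : comPzRingType) (I : set A) : Prop :=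
  [/\ is_ideal I,
      exists2 a, I a & a != 0 &
      forall J : set A, is_ideal J -> (exists2 a, J a & a != 0) ->
        exists2 a, (I `&` J) a & a != 0].

Record closed_set_ideal (X : topologicalType) := ClosedSetIdeal {
  ideal_sets :> set X -> Prop;
  ideal_sets_nonempty : exists A, ideal_sets A;
  ideal_sets_closed : forall A, ideal_sets A -> closed A;
  ideal_setsU : forall A B, ideal_sets A -> ideal_sets B ->
    ideal_sets (A `|` B);
  ideal_setsS : forall A B, ideal_sets A -> B `<=` A -> closed B ->
    ideal_sets B
}.

Definition almost_locally (X : topologicalType) (P : closed_set_ideal X) :=
  forall U : set X, open U -> U !=set0 ->
    exists V : set X, [/\ open V, V !=set0, V `<=` U & P (closure V)].

(* The ring structure of C(X) is that of a subring of the ring X -> R of all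
   functions, with pointwise operations. *)
Section continuous_function_ring.
Context {X : topologicalType} {R : realType}.
Notation T := (continuousType X R).

Definition cfun : {pred X -> R} := mem [set f : X -> R | continuous f].

Section Sub.
Context (f : X -> R) (fP : f \in cfun).
Definition cfun_Sub_subproof := @isContinuous.Build X R f (set_mem fP).
#[local] HB.instance Definition _ := cfun_Sub_subproof.
Definition cfun_Sub : T := f.
End Sub.

Lemma cfun_rect (K : T -> Type) :
  (forall f (Pf : f \in cfun), K (cfun_Sub Pf)) -> forall u : T, K u.
Proof.
move=> Ksub [f [[Pf]]]/=.
by suff -> : Pf = (set_mem (@mem_set _ [set f | _] f Pf)) by apply: Ksub.
Qed.

Lemma cfun_valP f (Pf : f \in cfun) : cfun_Sub Pf = f :> (_ -> _).
Proof. by []. Qed.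

HB.instance Definition _ := isSub.Build _ _ T cfun_rect cfun_valP.

Lemma cfun_subring_closed : subring_closed cfun.
Proof.
split=> [|f g|f g]; rewrite !inE /=.
- exact: cst_continuous.
- by move=> cf cg x; apply: cvgB; [exact: cf|exact: cg].
- by move=> cf cg x; apply: cvgM; [exact: cf|exact: cg].
Qed.

HB.instance Definition _ := GRing.isSubringClosed.Build _ cfun
  cfun_subring_closed.
HB.instance Definition _ := GRing.SubChoice_isSubComPzRing.Build _ cfun T
  cfun_subring_closed.

Lemma cfun0E (x : X) : (0 : T) x = 0. Proof. by []. Qed.
Lemma cfun1E (x : X) : (1 : T) x = 1. Proof. by []. Qed.
Lemma cfunDE (f g : T) (x : X) : (f + g) x = f x + g x. Proof. by []. Qed.
Lemma cfunNE (f : T) (x : X) : (- f) x = - f x. Proof. by []. Qed.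
Lemma cfunME (f g : T) (x : X) : (f * g) x = f x * g x. Proof. by []. Qed.

End continuous_function_ring.

Section subsets_of_CX.
Context {X : topologicalType} {R : realType}.
Notation CX := (continuousType X R).
Implicit Types (P : closed_set_ideal X) (f g : CX).

Definition zero_set f : set X := [set x | f x = 0].

Definition Cstar : set CX := [set f | bounded_fun (f : X -> R)].

Definition C_ideal P : set CX := [set f | P (closure (~` zero_set f))].

Definition Cinfty P : set CX :=
  [set f | forall e : R, 0 < e -> P [set x | e <= `|f x|]].

Definition CstarDCinfty P : {pred CX} :=
  mem [set g + f | g in Cstar & f in Cinfty P].

Lemma CstarP f : Cstar f <-> exists2 M : R, 0 < M & forall x, `|f x| <= M.
Proof.
split=> [[M [_ Mf]]|[M M0 Mf]].
  exists (`|M| + 1) => [|x]; first by rewrite ltr_wpDl.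
  by apply: Mf => //; rewrite (le_lt_trans (ler_norm _))// ltrDl.
exists M; split; first exact: num_real.
by move=> N MN x _ /=; exact: le_trans (Mf x) (ltW MN).
Qed.

Lemma closed_ge_norm f (e : R) : closed [set x | e <= `|f x|].
Proof.
apply: (@preimage_closed X R (fun x => `|f x|) [set y | e <= y]) => [x _|].
  by apply: cvg_norm; exact: cts_fun.
exact: closed_ge.
Qed.

Lemma Cstar1 : Cstar 1.
Proof. by apply/CstarP; exists 1 => // x; rewrite cfun1E normr1. Qed.

Lemma CstarN f : Cstar f -> Cstar (- f).
Proof.
by move=> /CstarP[M M0 Mf]; apply/CstarP; exists M => // x; rewrite cfunNE normrN.
Qed.

Lemma CstarD f g : Cstar f -> Cstar g -> Cstar (f + g).
Proof.
move=> /CstarP[M M0 Mf] /CstarP[N N0 Ng]; apply/CstarP; exists (M + N) => [|x].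
  exact: addr_gt0.
by rewrite cfunDE (le_trans (ler_normD _ _))// lerD.
Qed.

Lemma CstarM f g : Cstar f -> Cstar g -> Cstar (f * g).
Proof.
move=> /CstarP[M M0 Mf] /CstarP[N N0 Ng]; apply/CstarP; exists (M * N) => [|x].
  exact: mulr_gt0.
by rewrite cfunME normrM ler_pM.
Qed.

Lemma Cinfty0 P : Cinfty P 0.
Proof.
move=> e e0; have [A PA] := ideal_sets_nonempty P.
apply: (ideal_setsS PA); last exact: closed_ge_norm.
by move=> x; rewrite /mkset cfun0E normr0 leNgt e0.
Qed.

Lemma CinftyN P f : Cinfty P f -> Cinfty P (- f).
Proof.
move=> Pf e e0; apply: (ideal_setsS (Pf e e0)); last exact: closed_ge_norm.
by move=> x; rewrite /mkset cfunNE normrN.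
Qed.

Lemma CinftyD P f g : Cinfty P f -> Cinfty P g -> Cinfty P (f + g).
Proof.
move=> Pf Pg e e0; have e20 : 0 < e / 2 by exact: divr_gt0.
apply: (ideal_setsS (ideal_setsU (Pf _ e20) (Pg _ e20))); last first.
  exact: closed_ge_norm.
move=> x; rewrite /mkset cfunDE => efg; apply/orP; apply: contraT.
rewrite negb_or -!ltNge => /andP[fe ge].
have := le_lt_trans (ler_normD (f x) (g x)) (ltrD fe ge).
by rewrite -splitr ltNge efg.
Qed.

Lemma Cinfty_mulr P g f : Cstar g -> Cinfty P f -> Cinfty P (g * f).
Proof.
move=> /CstarP[M M0 Mg] Pf e e0; have eM0 : 0 < e / M by exact: divr_gt0.
apply: (ideal_setsS (Pf _ eM0)); last exact: closed_ge_norm.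
move=> x; rewrite /mkset cfunME normrM => egf; rewrite ler_pdivrMr// mulrC.
by apply: le_trans egf _; apply: ler_wpM2r.
Qed.

Lemma CinftyM P f g : Cinfty P f -> Cinfty P g -> Cinfty P (f * g).
Proof.
move=> Pf Pg e e0.
apply: (ideal_setsS (ideal_setsU (Pf _ e0) (Pg _ ltr01))); last first.
  exact: closed_ge_norm.
move=> x; rewrite /mkset cfunME normrM => efg; apply/orP; apply: contraT.
rewrite negb_or -!ltNge => /andP[fe g1]; move: efg; rewrite leNgt => /negP[].
by rewrite (le_lt_trans _ fe)// ler_piMr// ltW.
Qed.

Lemma CstarDCinfty_subring_closed P : subring_closed (CstarDCinfty P).
Proof.
split=> [|_ _ /set_mem[g Cg [f Pf <-]] /set_mem[g' Cg' [f' Pf' <-]]|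
          _ _ /set_mem[g Cg [f Pf <-]] /set_mem[g' Cg' [f' Pf' <-]]].
- by apply/mem_set; exists 1; [exact: Cstar1|exists 0; [exact: Cinfty0|rewrite addr0]].
- apply/mem_set; exists (g - g'); first by apply: CstarD => //; exact: CstarN.
  exists (f - f'); first by apply: CinftyD => //; exact: CinftyN.
  by rewrite opprD addrACA.
- apply/mem_set; exists (g * g'); first exact: CstarM.
  exists (g * f' + (g' * f + f * f')).
    by do 2?apply: CinftyD; [exact: Cinfty_mulr..|exact: CinftyM].
  by rewrite mulrDl !mulrDr (mulrC g' f) !addrA.
Qed.

End subsets_of_CX.

(* The ring C^*(X) + C_oo^P(X), as a subring of C(X). *)
Section CstarDCinfty_ring.
Context {X : topologicalType} (R : realType) (P : closed_set_ideal X).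

Definition CstarDCinfty_ring : Type :=
  {f : continuousType X R | f \in CstarDCinfty P}.

HB.instance Definition _ :=
  SubChoice.copy CstarDCinfty_ring {f | f \in CstarDCinfty P}.
HB.instance Definition _ :=
  GRing.SubChoice_isSubComPzRing.Build _ _ CstarDCinfty_ring
    (CstarDCinfty_subring_closed (R := R) P).

Definition Cinfty_sub : set CstarDCinfty_ring := [set f | Cinfty P (val f)].

End CstarDCinfty_ring.

Arguments Cinfty_sub {X} R P _.

(* Main.v *)
Require Import Defs.
From mathcomp Require Import all_boot all_order all_algebra.
From mathcomp Require Import all_classical all_reals all_analysis.
Import numFieldNormedType.Exports.

(** Essentiality of an ideal I of a nonzero ring A only has to be tested on
    principal ideals: every a <> 0 needs a multiple r a <> 0 in I.  If X is
    almost locally-P, take r to be a bump function supported in an open V inside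
    the cozero set of a with closure in P.  If r a is a nonzero element of C_P,
    then b = r a lies in C_oo^P and b a is nonzero, although r itself need not
    belong to C^* + C_oo^P.  Finally, if b = r f lies in C_oo^P, where f is a
    bump function supported in U, and b x <> 0, then {|b| > |b x| / 2} is the
    required open subset of U. *)

Import Order.TTheory GRing.Theory Num.Theory.
Local Open Scope classical_set_scope.
Local Open Scope ring_scope.

Lemma is_ideal_principal (A : comPzRingType) (a : A) :
  is_ideal (range (fun r => r * a)).
Proof.
split=> [|_ _ [r _ <-] [s _ <-]|r _ [s _ <-]].
- by exists 0; rewrite ?mul0r.
- by exists (r + s); rewrite ?mulrDl.
- by exists (r * s); rewrite ?mulrA.
Qed.

(** Forward, [I] is intersected with the principal ideal of [a]; backward, a multiple of an element
    of [J] stays in [J]. *)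
Lemma essential_idealP (A : comPzRingType) (I : set A) :
  (1 : A) != 0 -> is_ideal I ->
  essential_ideal I <->
  forall a, a != 0 -> exists2 r, I (r * a) & r * a != 0.
Proof.
move=> A1 idI; split=> [[_ _ Iess] a a0|Iess].
  have [|b [Ib [r _ rab]] b0] := Iess _ (is_ideal_principal _ a).
    by exists a => //; exists 1; rewrite ?mul1r.
  by exists r; rewrite rab.
split=> // [|J [_ _ JM] [a Ja a0]]; last first.
  have [r Ira ra0] := Iess a a0.
  by exists (r * a) => //; split=> //; exact: JM.
(* Testing against [a = 1] shows that [I] itself is nonzero. *)
by have [r] := Iess 1 A1; rewrite mulr1; exists r.
Qed.

Section continuous_functions.
Context {R : realType} {X : topologicalType}.
Notation CX := (continuousType X R).
Implicit Types (P : closed_set_ideal X) (f g : CX).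

Lemma cfun_eq0P f : f = 0 <-> forall x, f x = 0.
Proof. by split=> [->//|f0]; apply: val_inj; apply/funext. Qed.

Lemma cfun_neq0P f : f != 0 <-> exists x, f x != 0.
Proof.
split=> [/eqP f0|[x]]; last by apply: contraNneq => ->.
apply: contrapT => /forallNP f0'; apply/f0/cfun_eq0P => x.
by apply/eqP/negPn/negP.
Qed.

(** Nonemptiness of [X] enters here: over the empty space the ring is zero and has no nonzero
    ideal. *)
Lemma cfun1_neq0 : [set: X] !=set0 -> (1 : CX) != 0.
Proof.
by move=> [x _]; apply/cfun_neq0P; exists x; rewrite cfun1E oner_neq0.
Qed.

Lemma open_cozero f : open (~` zero_set f).
Proof.
apply: closed_openC; apply: (@preimage_closed X R f [set y | y = 0]) => [x _|].
  exact: cts_fun.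
exact: closed_eq.
Qed.

Lemma open_gt_norm f (e : R) : open [set x | e < `|f x|].
Proof.
apply: (@open_comp X R (fun x => `|f x|) [set y | e < y]) => [x _|].
  by apply: cvg_norm; exact: cts_fun.
exact: open_gt.
Qed.

Lemma completely_regular_bump (U : set X) (x : X) :
  completely_regular_space X -> open U -> U x ->
  exists f, [/\ Cstar f, f x = 1 & forall y, f y != 0 -> U y].
Proof.
move=> crX oU Ux.
have /(@uniform_separatorP _ R)[h [ch h01 hx hU]] :
    uniform_separator [set x] (~` U).
  by apply: crX; [exact: open_closedC|exact].
have [g gE] : exists g, g = h :> (X -> R) by exists (cfun_Sub (mem_set ch)).
(* The separating function is 0 at [x] and 1 off [U], so its complement to 1 is the bump. *)
exists (1 - g); split.
- apply: CstarD; first exact: Cstar1.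
  apply/CstarN/CstarP; exists 1 => // y; rewrite gE.
  have /= := h01 (h y) (ex_intro2 _ _ y I erefl).
  by rewrite in_itv/= => /andP[h0 h1]; rewrite ger0_norm.
- rewrite cfunDE cfunNE cfun1E gE.
  have -> : h x = 0 by apply: hx; exists x.
  by rewrite subr0.
- move=> y; apply: contra_neqP => Uy.
  rewrite cfunDE cfunNE cfun1E gE.
  have -> : h y = 1 by apply: hU; exists y.
  by rewrite subrr.
Qed.

Lemma is_ideal_C_ideal P : @is_ideal CX (C_ideal P).
Proof.
split=> [|f g Pf Pg|g f Pf].
- have [A PA] := ideal_sets_nonempty P.
  rewrite /C_ideal/= (_ : ~` _ = set0) ?closure0; last first.
    by rewrite -subset0 => x /=; apply.
  by apply: (ideal_setsS PA); [exact: sub0set|exact: closed0].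
(* The cozero set of a sum lies in the union of the two cozero sets, and closure commutes with
   finite unions. *)
- apply: (ideal_setsS (ideal_setsU Pf Pg)); last exact: closed_closure.
  rewrite -closureU; apply: closureS => x fgx.
  apply: contrapT => /not_orP[/contrapT fx /contrapT gx]; apply: fgx.
  by rewrite /zero_set/mkset cfunDE fx gx addr0.
- apply: (ideal_setsS Pf); last exact: closed_closure.
  apply: closureS => x; apply: contra_not => fx.
  by rewrite /zero_set/mkset cfunME fx mulr0.
Qed.

(** For [e > 0], the closed set where [|f| >= e] lies inside the cozero set of [f]. *)
Lemma C_ideal_sub_Cinfty P : @C_ideal X R P `<=` Cinfty P.
Proof.
move=> f Pf e e0; apply: (ideal_setsS Pf); last exact: closed_ge_norm.
apply: subset_trans (@subset_closure _ _) => x /= efx fx.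
by move: efx; rewrite fx normr0 leNgt e0.
Qed.

Lemma mem_CstarDCinfty_Cstar P f : Cstar f -> f \in CstarDCinfty P.
Proof.
move=> Cf; apply/mem_set; exists f => //.
by exists 0; [exact: Cinfty0|rewrite addr0].
Qed.

Lemma mem_CstarDCinfty_Cinfty P f : Cinfty P f -> f \in CstarDCinfty P.
Proof.
move=> Pf; apply/mem_set; exists 0; last by exists f => //; rewrite add0r.
by apply/CstarP; exists 1 => // x; rewrite cfun0E normr0.
Qed.

(** A multiplier splits as [g + h] with [g] bounded and [h] in [Cinfty P]; each summand maps
    [Cinfty P] into itself. *)
Lemma is_ideal_Cinfty P : is_ideal (Cinfty_sub R P).
Proof.
split=> [|f g|[r rP] f Pf].
- exact: Cinfty0.
- exact: CinftyD.
- have [g Cg [h Ph ghr]] := set_mem rP; rewrite /Cinfty_sub/= -ghr mulrDl.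
  by apply: CinftyD; [exact: Cinfty_mulr|exact: CinftyM].
Qed.

Lemma almost_locally_essential P :
  [set: X] !=set0 -> completely_regular_space X ->
  almost_locally P -> @essential_ideal CX (C_ideal P).
Proof.
move=> X0 crX alP.
apply/essential_idealP; [exact: cfun1_neq0|exact: is_ideal_C_ideal|].
move=> a /cfun_neq0P[x ax].
have [|V [oV [y Vy] Va PV]] := alP _ (open_cozero a).
  by exists x; apply/eqP.
have [f [_ fy fV]] := completely_regular_bump _ _ crX oV Vy; exists f.
(* The cozero set of [f * a] lies in that of [f], hence in [V]. *)
- apply: (ideal_setsS PV); last exact: closed_closure.
  apply: closureS => z; rewrite /zero_set => /eqP; rewrite cfunME.
  by rewrite mulf_eq0 negb_or => /andP[/fV].
- by apply/cfun_neq0P; exists y; rewrite cfunME fy mul1r; apply/eqP/Va.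
Qed.

Lemma C_ideal_essential_Cinfty P : [set: X] !=set0 ->
  @essential_ideal CX (C_ideal P) -> essential_ideal (Cinfty_sub R P).
Proof.
move=> X0 /(essential_idealP _ _ (cfun1_neq0 X0) (is_ideal_C_ideal P)) ess.
apply/essential_idealP; [exact: cfun1_neq0|exact: is_ideal_Cinfty|].
move=> a a0; have [r /C_ideal_sub_Cinfty Pra] := ess (val a) a0.
move=> /cfun_neq0P[x]; rewrite cfunME mulf_eq0 negb_or => /andP[rx ax].
have [_ _ idealM] := is_ideal_Cinfty P.
(* The multiplier is [r * val a]; its product with [a] is nonzero at [x], where neither [r] nor [a]
   vanishes. *)
exists (exist (fun h => h \in CstarDCinfty P) _ (mem_CstarDCinfty_Cinfty _ _ Pra)).
  by rewrite mulrC; exact: idealM.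
have : r * val a * val a != 0.
  by apply/cfun_neq0P; exists x; rewrite !cfunME !mulf_neq0.
by apply: contra_neq => /(congr1 val).
Qed.

Lemma Cinfty_essential_almost_locally P :
  [set: X] !=set0 -> completely_regular_space X ->
  essential_ideal (Cinfty_sub R P) -> almost_locally P.
Proof.
move=> X0 crX.
have S1 : (1 : CstarDCinfty_ring R P) != 0 by exact: cfun1_neq0.
move=> /(essential_idealP _ _ S1 (is_ideal_Cinfty P)) ess U oU [x Ux].
have [f [Cf fx fU]] := completely_regular_bump _ _ crX oU Ux.
have [b [Pb [z bz] bU]] : exists b : CX,
    [/\ Cinfty P b, exists z, b z != 0 & forall y, b y != 0 -> U y].
  (* The bump is bounded, so it belongs to the subring and can be tested there. *)
  have [|r Prf rf0] :=
      ess (exist (fun h => h \in CstarDCinfty P) _ (mem_CstarDCinfty_Cstar P _ Cf)).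
    by apply/(cfun_neq0P f); exists x; rewrite fx oner_neq0.
  exists (val r * f); split=> [//||y]; first exact/cfun_neq0P.
  by rewrite cfunME mulf_eq0 negb_or => /andP[_ /fU].
have bz0 : 0 < `|b z| / 2 by rewrite divr_gt0 ?normr_gt0.
(* The strict inequality makes the set open; its closure stays in the set given by the weak one,
   which is in [P]. Halving keeps [z] inside. *)
exists [set y | `|b z| / 2 < `|b y|]; split.
- exact: open_gt_norm.
- by exists z => /=; rewrite ltr_pdivrMr// mulr_natr mulr2n ltrDl normr_gt0.
- move=> y /= /(lt_trans bz0).
  by rewrite normr_gt0 => /bU.
- apply: (ideal_setsS (Pb _ bz0)); last exact: closed_closure.
  apply: subset_trans (@closed_ge_norm _ _ b (`|b z| / 2)).
  by apply: closureS => y /=; exact: ltW.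
Qed.

End continuous_functions.

Local Close Scope ring_scope.
Local Close Scope classical_set_scope.

Theorem theorem4p5 (R : realType) (X : topologicalType) (P : closed_set_ideal X)
    (X_nonempty : ([set: X] !=set0)%classic)
    (X_hausdorff : hausdorff_space X)
    (X_completely_regular : completely_regular_space X) :
  [<-> almost_locally P;
       @essential_ideal (continuousType X R) (C_ideal P);
       @essential_ideal (CstarDCinfty_ring R P) (Cinfty_sub R P)].

Proof.
tfae.
- exact: almost_locally_essential.
- exact: C_ideal_essential_Cinfty.
- exact: Cinfty_essential_almost_locally.
Qed.
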